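(* Let $\mathcal{R}$ be a commutative ring, $\mathbf{M}$ an $\mathcal{R}$-module, $p\ge1$ and $d_1,\ldots,d_p\ge1$ integers, and $\mathbf{a}^{(i)}=(a^{(i)}_1,\ldots,a^{(i)}_{d_i})\in\mathcal{R}^{d_i}$ for $i=1,\ldots,p$. Let $(x_{n_1,\ldots,n_p})_{n_i\ge0}$ be a multiple Fibonacci sequence in $\mathbf{M}$ of type $(\mathbf{a}^{(1)},\ldots,\mathbf{a}^{(p)})$. Then its generating function $G(t_1,\ldots,t_p)=\sum_{n_1,\ldots,n_p\ge0}x_{n_1,\ldots,n_p}t_1^{n_1}\cdots t_p^{n_p}$ is rational and is given by $$G(t_1,\ldots,t_p)=q_1(t_1)^{-1}\cdots q_p(t_p)^{-1}\Big[\sum_{0\le j_i\le d_i-1\ (i=1,\ldots,p)}Q^{(1)}_{j_1}(t_1)\cdots Q^{(p)}_{j_p}(t_p)\,x_{j_1,\ldots,j_p}\Big],$$ where $$q_i(t)=1-a^{(i)}_1t-\cdots-a^{(i)}_{d_i}t^{d_i}$$ and, for $0\le j\le d_i-1$, $$Q^{(i)}_j(t)=t^j\big(1-a^{(i)}_1t-a^{(i)}_2t^2-\cdots-a^{(i)}_{d_i-j-1}t^{d_i-j-1}\big).$$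
   Context: A multiple Fibonacci sequence in $\mathbf{M}$ of type $(\mathbf{a}^{(1)},\ldots,\mathbf{a}^{(p)})$ is a multiple sequence $(x_{n_1,\ldots,n_p})_{n_1,\ldots,n_p\ge0}$ in $\mathbf{M}$ such that for every $i=1,\ldots,p$ and all $n_1,\ldots,n_p\ge0$ $$x_{n_1,\ldots,n_i+d_i,\ldots,n_p}=\sum_{j=1}^{d_i}a^{(i)}_j\,x_{n_1,\ldots,n_i+d_i-j,\ldots,n_p}.$$ The generating function lies in $\mathbf{M}[[t_1,\ldots,t_p]]$, viewed as a module over $\mathcal{R}[[t_1,\ldots,t_p]]$, in which the inverses $q_i(t_i)^{-1}$ are taken. For $j=d_i-1$ the sum in the definition of $Q_j^{(i)}$ is empty, so $Q^{(i)}_{d_i-1}(t)=t^{d_i-1}$. *)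

(* Defs.v *)
(* Mathematical Components, with classical choice for the eqType/choiceType
   structure on power series and for the inverse of a power series. *)
From HB Require Import structures.
From mathcomp Require Import all_boot all_order all_algebra.
From mathcomp Require Import boolp.
From mathcomp.multinomials Require Import mpoly.

Set Implicit Arguments.
Unset Strict Implicit.
Unset Printing Implicit Defensive.

Import GRing.Theory.
Local Open Scope ring_scope.

(* [series p V] is V[[t_1, ..., t_p]]: a formal power series is the family of
   its coefficients, indexed by the exponents n = (n_1, ..., n_p) : 'X_{1..p}.
   The record prevents the pointwise structures on functions from being
   inferred. *)
Record series (p : nat) (V : Type) := Series { coefs : 'X_{1..p} -> V }.

Arguments Series {p V} coefs.

HB.instance Definition _ p V := [isNew for @coefs p V].
HB.instance Definition _ p (V : choiceType) := [Choice of series p V by <:].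

Lemma seriesP p V (f g : series p V) : (forall n, coefs f n = coefs g n) -> f = g.
Proof. by case: f g => [f] [g] /= /funext ->. Qed.

Section Additive.
Variables (p : nat) (V : zmodType).
Implicit Types f g h : series p V.

Definition series_zero : series p V := Series (fun=> 0).
Definition series_opp f : series p V := Series (fun n => - coefs f n).
Definition series_add f g : series p V :=
  Series (fun n => coefs f n + coefs g n).

Fact series_addA : associative series_add.
Proof. by move=> f g h; apply/seriesP => n /=; rewrite addrA. Qed.
Fact series_addC : commutative series_add.
Proof. by move=> f g; apply/seriesP => n /=; rewrite addrC. Qed.
Fact series_add0 : left_id series_zero series_add.
Proof. by move=> f; apply/seriesP => n /=; rewrite add0r. Qed.
Fact series_addN : left_inverse series_zero series_opp series_add.
Proof. by move=> f; apply/seriesP => n /=; rewrite addNr. Qed.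

HB.instance Definition _ := GRing.isZmodule.Build (series p V)
  series_addA series_addC series_add0 series_addN.

Lemma coefs0 n : coefs (0 : series p V) n = 0. Proof. by []. Qed.
Lemma coefsD f g n : coefs (f + g) n = coefs f n + coefs g n.
Proof. by []. Qed.
Lemma coefsN f n : coefs (- f) n = - coefs f n. Proof. by []. Qed.
Lemma coefsB f g n : coefs (f - g) n = coefs f n - coefs g n.
Proof. by []. Qed.
Lemma coefs_sum I (r : seq I) P (F : I -> series p V) n :
  coefs (\sum_(i <- r | P i) F i) n = \sum_(i <- r | P i) coefs (F i) n.
Proof. exact: (big_morph (fun f => coefs f n)). Qed.

Definition seriesC (v : V) : series p V :=
  Series (fun n => if n == 0%MM then v else 0).

End Additive.

Arguments seriesC {p V} v.

(* The Cauchy product of a scalar series and a series with coefficients in a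
   module: (f . v)_n = \sum_(n = i + j) f_i v_j.  Exponents i, j with
   n = i + j have total degree at most [mdeg n]. *)
Definition series_scale (p : nat) (R : pzRingType) (M : lmodType R)
    (f : series p R) (v : series p M) : series p M :=
  Series (fun n => \sum_(i : 'X_{1..p < (mdeg n).+1})
    \sum_(j : 'X_{1..p < (mdeg n).+1} | n == (i + j)%MM)
      coefs f i *: coefs v j).

Lemma mnm_subE p (n i j : 'X_{1..p}) : n = (i + j)%MM -> (n - i)%MM = j.
Proof. by move=> ->; rewrite addmC addmK. Qed.

Lemma mnm_le_addr p (n i j : 'X_{1..p}) : n = (i + j)%MM -> (i <= n)%MM.
Proof. by move=> ->; exact: lem_addr. Qed.

Lemma big_bmultinom p (V : zmodType) b b' (n : 'X_{1..p}) (F : 'X_{1..p} -> V) :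
    (mdeg n < b)%N -> (mdeg n < b')%N ->
  \sum_(i : 'X_{1..p < b} | (i <= n)%MM) F i =
  \sum_(i : 'X_{1..p < b'} | (i <= n)%MM) F i.
Proof.
have le_deg (i : 'X_{1..p}) : (i <= n)%MM -> (mdeg i <= mdeg n)%N.
  by move=> /submK <-; rewrite mdegD leq_addl.
pose s c := [seq i <- map (@bmnm p c) (enum {: 'X_{1..p < c}}) | (i <= n)%MM].
have E c : \sum_(i : 'X_{1..p < c} | (i <= n)%MM) F i = \sum_(i <- s c) F i.
  by rewrite big_filter big_map big_enum_cond.
have mem_s c i : (mdeg n < c)%N -> (i \in s c) = (i <= n)%MM.
  move=> nc; rewrite mem_filter andb_idr // => /le_deg le_in.
  apply/mapP; exists (BMultinom (leq_ltn_trans le_in nc)) => //.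
  by rewrite mem_enum.
have uniq_s c : uniq (s c).
  by rewrite filter_uniq // map_inj_uniq ?enum_uniq //; apply: val_inj.
move=> nb nb'; rewrite !E; apply: perm_big; apply: uniq_perm => // i.
by rewrite !mem_s.
Qed.

Section Scale.
Variables (p : nat) (R : pzRingType) (M : lmodType R).
Implicit Types (f g : series p R) (v w : series p M).

Lemma coefsZ_le b f v n : (mdeg n < b)%N -> coefs (series_scale f v) n =
  \sum_(i : 'X_{1..p < b} | (i <= n)%MM) coefs f i *: coefs v (n - i)%MM.
Proof.
move=> nb /=.
rewrite (big_bmultinom (fun i => coefs f i *: coefs v (n - i)%MM) nb (ltnSn _)).
rewrite [RHS]big_mkcond /=; apply: eq_bigr => i _.
case: ifPn => [le_in|nle].
  have lt : (mdeg (n - i)%MM < (mdeg n).+1)%N by rewrite ltnS mdegB.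
  rewrite (bigD1 (BMultinom lt)) /=; last by apply/eqP; rewrite addmC submK.
  rewrite big1 ?addr0 // => j /andP[/eqP E /eqP[]].
  by apply/val_inj; rewrite /= (mnm_subE E).
rewrite big_pred0 // => j; apply: contraNF nle => /eqP.
exact: mnm_le_addr.
Qed.

Lemma coefsZ b f v n : (mdeg n < b)%N -> coefs (series_scale f v) n =
  \sum_(i : 'X_{1..p < b}) \sum_(j : 'X_{1..p < b} | n == (i + j)%MM)
     coefs f i *: coefs v j.
Proof.
move=> nb; rewrite (coefsZ_le _ _ nb) big_mkcond /=; apply: eq_bigr => i _.
case: ifPn => [le_in|nle].
  have lt : (mdeg (n - i)%MM < b)%N by apply: leq_ltn_trans nb; rewrite mdegB.
  rewrite (bigD1 (BMultinom lt)) /=; last by apply/eqP; rewrite addmC submK.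
  rewrite big1 ?addr0 // => j /andP[/eqP E /eqP[]].
  by apply/val_inj; rewrite /= (mnm_subE E).
rewrite big_pred0 // => j; apply: contraNF nle => /eqP.
exact: mnm_le_addr.
Qed.

Fact series_scaleDr f : {morph @series_scale p R M f : v w / v + w}.
Proof.
move=> v w; apply/seriesP => n; rewrite coefsD !(coefsZ_le _ _ (ltnSn _)).
by rewrite -big_split; apply: eq_bigr => i _ /=; rewrite scalerDr.
Qed.

Fact series_scaleDl v : {morph (@series_scale p R M)^~ v : f g / f + g}.
Proof.
move=> f g; apply/seriesP => n; rewrite coefsD !(coefsZ_le _ _ (ltnSn _)).
by rewrite -big_split; apply: eq_bigr => i _ /=; rewrite scalerDl.
Qed.

Lemma coefs_scaleC c v n : coefs (series_scale (seriesC c) v) n = c *: coefs v n.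
Proof.
rewrite (coefsZ_le _ _ (ltnSn _)).
have lt : (mdeg (0%MM : 'X_{1..p}) < (mdeg n).+1)%N by rewrite mdeg0.
rewrite (bigD1 (BMultinom lt)) /=; last by apply/mnm_lepP => i; rewrite mnm0E.
rewrite subm0 eqxx big1 ?addr0 // => i.
by case/andP=> _ ne; rewrite -val_eqE /= in ne; rewrite (negPf ne) scale0r.
Qed.

Fact series_scale1 : left_id (seriesC 1) (@series_scale p R M).
Proof. by move=> v; apply/seriesP => n; rewrite coefs_scaleC scale1r. Qed.

End Scale.

Lemma big_mnm_eq p (V : zmodType) b (P : pred 'X_{1..p}) (e : 'X_{1..p}) (v : V) :
    (P e -> (mdeg e < b)%N) ->
  \sum_(j : 'X_{1..p < b} | P j && (bmnm j == e)) v = if P e then v else 0.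
Proof.
case: ifPn => [Pe /(_ isT) lt | nPe _]; last first.
  by rewrite big_pred0 // => j; apply: contraNF nPe => /andP[Pj /eqP <-].
rewrite (bigD1 (BMultinom lt)) /= ?Pe ?eqxx // big1 ?addr0 // => j.
by case/andP=> /andP[_ /eqP E] /eqP[]; apply/val_inj.
Qed.

Fact series_scaleA p (R : pzRingType) (M : lmodType R)
    (f g : series p R) (v : series p M) :
  series_scale f (series_scale g v) =
  series_scale (series_scale f (g : series p R^o) : series p R) v.
Proof.
apply/seriesP => n.
have [b nb] : exists b, (mdeg n < b)%N by exists (mdeg n).+1.
have le_deg (i j : 'X_{1..p}) : n == (i + j)%MM -> (mdeg j < b)%N.
  by move=> /eqP E; apply: leq_ltn_trans nb; rewrite E mdegD leq_addl.
transitivity (\sum_(i : 'X_{1..p < b}) \sum_(k : 'X_{1..p < b})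
    \sum_(l : 'X_{1..p < b} | n == (i + (k + l))%MM)
    (coefs f i * coefs g k) *: coefs v l).
  rewrite (coefsZ _ _ nb); apply: eq_bigr => i _.
  under eq_bigr => j _.
    rewrite (coefsZ _ _ (bmdeg j)) scaler_sumr.
    under eq_bigr do rewrite scaler_sumr.
    over.
  rewrite exchange_big; apply: eq_bigr => k _.
  rewrite (exchange_big_dep xpredT) //= [RHS]big_mkcond /=.
  apply: eq_bigr => l _.
  rewrite (big_mnm_eq (P := fun j => n == (i + j)%MM)) ?scalerA //.
  exact: le_deg.
rewrite (coefsZ _ _ nb).
under [RHS]eq_bigr => m _.
  under eq_bigr => l _.
    rewrite (coefsZ _ _ (bmdeg m)) scaler_suml.
    under eq_bigr do rewrite scaler_suml.
    over.
  rewrite exchange_big.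
  under eq_bigr do rewrite exchange_big.
  over.
rewrite [RHS]exchange_big; apply: eq_bigr => i _ /=.
rewrite [RHS](exchange_big_dep xpredT) //=; apply: eq_bigr => k _.
rewrite [RHS](exchange_big_dep xpredT) //= [LHS]big_mkcond /=.
apply: eq_bigr => l _; rewrite addmA; under [RHS]eq_bigl do rewrite andbC.
rewrite (big_mnm_eq (P := fun m => n == (m + l)%MM)) //.
by move=> /eqP E; apply: leq_ltn_trans nb; rewrite E [leqRHS]mdegD leq_addr.
Qed.

Section Ring.
Variables (p : nat) (R : comPzRingType).
Implicit Types f g h : series p R.

Definition series_mul f g : series p R := series_scale f (g : series p R^o).

Fact series_mulA : associative series_mul.
Proof. by move=> f g h; exact: (series_scaleA f g (h : series p R^o)). Qed.

Fact series_mulC : commutative series_mul.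
Proof.
move=> f g; apply/seriesP => n; rewrite /= (exchange_big_dep xpredT) //=.
apply: eq_bigr => i _; apply: eq_big => [j|j _]; first by rewrite addmC.
exact: mulrC.
Qed.

Fact series_mul1 : left_id (seriesC 1) series_mul.
Proof. by move=> f; exact: (series_scale1 (f : series p R^o)). Qed.

Fact series_mulDl : left_distributive series_mul +%R.
Proof. by move=> f g h; exact: (series_scaleDl (h : series p R^o)). Qed.

HB.instance Definition _ := GRing.Zmodule_isComPzRing.Build (series p R)
  series_mulA series_mulC series_mul1 series_mulDl.

Lemma coefsM f g n : coefs (f * g) n =
  \sum_(i : 'X_{1..p < (mdeg n).+1})
    \sum_(j : 'X_{1..p < (mdeg n).+1} | n == (i + j)%MM)
      coefs f i * coefs g j.
Proof. by []. Qed.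

Lemma coefs1 n : coefs (1 : series p R) n = (n == 0%MM)%:R.
Proof. by rewrite /=; case: eqP. Qed.

End Ring.

Section Module.
Variables (p : nat) (R : comPzRingType) (M : lmodType R).

Fact series_scaleA' (f g : series p R) (v : series p M) :
  series_scale f (series_scale g v) = series_scale (f * g) v.
Proof. exact: series_scaleA. Qed.

Fact series_scaleDl' (v : series p M) :
  {morph (@series_scale p R M)^~ v : f g / f + g}.
Proof. exact: series_scaleDl. Qed.

HB.instance Definition _ := GRing.Zmodule_isLmodule.Build
  (series p R) (series p M)
  series_scaleA' (@series_scale1 p R M) (@series_scaleDr p R M) series_scaleDl'.

Lemma coefs_scale (f : series p R) (v : series p M) n : coefs (f *: v) n =
  \sum_(i : 'X_{1..p < (mdeg n).+1})
    \sum_(j : 'X_{1..p < (mdeg n).+1} | n == (i + j)%MM)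
      coefs f i *: coefs v j.
Proof. by []. Qed.

End Module.

Section Inverse.
Variables (p : nat) (R : comPzRingType).
Implicit Types f g : series p R.

Definition series_unit f : Prop := exists g, g * f = 1.

(* Junk value [f] when [f] is not invertible, as for [GRing.inv]; the library's
   [unitRingType] would exclude the zero ring. *)
Definition series_inv f : series p R :=
  if pselect (series_unit f) is left f_unit then projT1 (cid f_unit) else f.

Lemma series_mulVf f : series_unit f -> series_inv f * f = 1.
Proof.
by rewrite /series_inv; case: pselect => // f_unit _; case: (cid f_unit).
Qed.

Lemma series_invE f g : g * f = 1 -> series_inv f = g.
Proof.
move=> gf1; have /series_mulVf f'f1 : series_unit f by exists g.
by rewrite -[LHS]mulr1 -gf1 [g * f]mulrC mulrA f'f1 mul1r.
Qed.

Lemma coefsXn_eq0 f k n :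
  coefs f 0%MM = 0 -> (mdeg n < k)%N -> coefs (f ^+ k) n = 0.
Proof.
move=> f0; elim: k n => // k IH n nk; rewrite exprS coefsM.
apply: big1 => -[i /= _] _; apply: big1 => -[j /= _] /eqP E.
have [i0|i_neq0] := eqVneq i 0%MM; first by rewrite i0 f0 mul0r.
rewrite IH ?mulr0 //.
rewrite -ltnS; apply: leq_trans nk.
by rewrite E mdegD ltnS -[X in (X < _)%N]add0n ltn_add2r lt0n mdeg_eq0.
Qed.

(* The inverse is the geometric series in 1 - f. *)
Lemma series_unit1 f : coefs f 0%MM = 1 -> series_unit f.
Proof.
move=> f1; pose h := 1 - f.
have h0 : coefs h 0%MM = 0 by rewrite coefsB coefs1 eqxx f1 subrr.
pose S b := \sum_(k < b) h ^+ k.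
have SE b n : (mdeg n < b)%N -> coefs (S b) n = coefs (S (mdeg n).+1) n.
  move=> nb; rewrite -(subnKC nb) /S big_split_ord coefsD.
  rewrite [X in _ + X]coefs_sum [X in _ + X]big1 ?addr0 // => k _.
  by apply: coefsXn_eq0; rewrite ?ltnS ?leq_addr.
exists (Series (fun n => coefs (S (mdeg n).+1) n)).
apply/seriesP => n; set b := (mdeg n).+1.
have -> : coefs (Series (fun m => coefs (S (mdeg m).+1) m) * f) n
    = coefs (S b * f) n.
  rewrite !coefsM; apply: eq_bigr => i _; apply: eq_bigr => j _.
  by rewrite (SE b _ (bmdeg i)).
have -> : f = 1 - h by rewrite /h opprB addrC subrK.
have -> : S b * (1 - h) = 1 - h ^+ b.
  by rewrite mulrC -[1 in RHS](expr1n _ b) subrXX; congr (_ * _);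
    apply: eq_bigr => k _; rewrite expr1n mul1r.
by rewrite coefsB coefsXn_eq0 ?subr0.
Qed.

End Inverse.

Definition seriesX (p : nat) (R : pzRingType) (i : 'I_p) : series p R :=
  Series (fun n => if n == U_(i)%MM then 1 else 0).

Arguments seriesX {p R} i.

Definition series_polynomial (p : nat) (V : zmodType) (f : series p V) : Prop :=
  exists N : nat, forall n, (N <= mdeg n)%N -> coefs f n = 0.

(* G = f^-1 P with f in R[t_1, ..., t_p] invertible in R[[t_1, ..., t_p]] and
   P in M[t_1, ..., t_p]. *)
Definition series_rational (p : nat) (R : comPzRingType) (M : lmodType R)
    (G : series p M) : Prop :=
  exists (f : series p R) (P : series p M),
    [/\ series_polynomial f, series_unit f, series_polynomial P
      & G = series_inv f *: P].

(* The entry a^(i)_j, 1 <= j <= d_i, is [a i (j - 1)]. *)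
Definition multiple_fibonacci (p : nat) (R : comPzRingType) (M : lmodType R)
    (d : 'I_p -> nat) (a : forall i : 'I_p, 'I_(d i) -> R)
    (x : 'X_{1..p} -> M) : Prop :=
  forall (i : 'I_p) (n : 'X_{1..p}),
    x (n + U_(i) *+ d i)%MM =
    \sum_(j < d i) a i j *: x (n + U_(i) *+ (d i - j.+1))%MM.

Definition generating_function (p : nat) (V : Type) (x : 'X_{1..p} -> V) :
  series p V := Series x.

Section Denominators.
Variables (p : nat) (R : comPzRingType) (d : nat) (a : 'I_d -> R).

(* q(t) = 1 - a_1 t - ... - a_d t^d *)
Definition fib_q (t : series p R) : series p R :=
  1 - \sum_(k < d) seriesC (a k) * t ^+ k.+1.

(* Q_j(t) = t^j (1 - a_1 t - ... - a_(d-j-1) t^(d-j-1)) *)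
Definition fib_Q (j : nat) (t : series p R) : series p R :=
  t ^+ j * (1 - \sum_(k < d | (k.+1 <= d - j - 1)%N) seriesC (a k) * t ^+ k.+1).

Lemma fib_q_unit (i : 'I_p) : series_unit (fib_q (seriesX i)).
Proof.
apply: series_unit1; rewrite /fib_q coefsB coefs1 eqxx coefs_sum big1 ?subr0 //.
move=> k _; rewrite [LHS](coefs_scaleC (M := R^o)) coefsXn_eq0 ?mulr0 ?mdeg0 //=.
  by rewrite scaler0.
by case: eqP => // /(congr1 (@mdeg p)); rewrite mdeg0 mdeg1.
Qed.

End Denominators.

(* Main.v *)
(* Put c_i(m) for the coefficients of q_i and q = q_1(t_1) ... q_p(t_p).  The
   recurrence in the i-th variable says that q_i(t_i) G has no term with
   n_i >= d_i, and multiplying by the series in the other variables preserves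
   this; so q G is supported on the box 0 <= n_i < d_i.  On the box its
   coefficient at n is the sum over m <= n of (prod_i c_i(n_i - m_i)) x_m, and
   Q^(i)_j(t) is exactly t^j q_i(t) truncated to degree < d_i. *)
Require Import Defs.
From mathcomp Require Import all_boot all_order all_algebra zify.
From mathcomp.multinomials Require Import mpoly.

Import GRing.Theory.
Local Open Scope ring_scope.

Set Implicit Arguments.
Unset Strict Implicit.
Unset Printing Implicit Defensive.

(** * Series in a single variable and their Cauchy products *)

(* The series sum_m f(m) t_i^m. *)
Definition series_univ (p : nat) (V : zmodType) (i : 'I_p) (f : nat -> V) :
    series p V :=
  Series (fun n => if n == (U_(i) *+ n i)%MM then f (n i) else 0).

Lemma mnmU_muln p (i k : 'I_p) m :
  (U_(i) *+ m)%MM k = if i == k then m else 0%N.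
Proof. by rewrite mulmnE mnm1E; case: eqP; rewrite ?mul1n ?mul0n. Qed.

Lemma mnmU_muln_le p (i : 'I_p) m (n : 'X_{1..p}) :
  (U_(i) *+ m <= n)%MM = (m <= n i)%N.
Proof.
apply/mnm_lepP/idP => [/(_ i)|le_mn k]; rewrite mnmU_muln ?eqxx //.
by case: eqP => // <-.
Qed.

Section Scale.
Variables (p : nat) (R : comPzRingType) (M : lmodType R).
Implicit Types (i : 'I_p) (v : series p M).

(** Among the exponents below [n], only the pure powers of t_i carry a nonzero coefficient of the
    left factor, so the Cauchy product collapses to a sum over one integer. *)
Lemma coefs_univZ i (f : nat -> R) v n :
  coefs (series_univ i f *: v) n =
  \sum_(k < (n i).+1) f k *: coefs v (n - U_(i) *+ k)%MM.
Proof.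
have [b nb] : exists b, (mdeg n < b)%N by exists (mdeg n).+1.
rewrite (coefsZ_le _ _ nb).
rewrite (bigID (fun m : 'X_{1..p < b} => bmnm m == (U_(i) *+ bmnm m i)%MM)) /=.
rewrite [X in _ + X]big1 ?addr0; last first.
  by move=> m /andP[_ /negPf ->]; rewrite scale0r.
have lt (k : 'I_(n i).+1) : (mdeg (U_(i) *+ k)%MM < b)%N.
  apply: leq_ltn_trans nb; have := ltn_ord k; rewrite ltnS -mnmU_muln_le.
  by move=> /submK/(congr1 (@mdeg p)) <-; rewrite mdegD leq_addl.
(* The pure powers of t_i below [n] correspond to k <= n_i; [inord] inverts this faithfully because
   m_i <= n_i whenever [m] lies below [n]. *)
rewrite (reindex_onto (fun k : 'I_(n i).+1 => BMultinom (lt k))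
  (fun m => inord (bmnm m i))) /=.
  apply: eq_big => [k|k _]; rewrite mnmU_muln eqxx ?inord_val ?eqxx //.
  by rewrite mnmU_muln_le -ltnS ltn_ord.
move=> m /andP[/mnm_lepP/(_ i) le_mn /eqP E]; apply: val_inj => /=.
by rewrite inordK ?ltnS.
Qed.

End Scale.

Lemma coefs_univM p (R : comPzRingType) (i : 'I_p) (f : nat -> R)
    (g : series p R) n :
  coefs (series_univ i f * g) n =
  \sum_(k < (n i).+1) f k * coefs g (n - U_(i) *+ k)%MM.
Proof. exact: (coefs_univZ i f (g : series p R^o)). Qed.

Lemma seriesX_univ p (R : comPzRingType) (i : 'I_p) :
  seriesX i = series_univ i (fun m => (m == 1)%:R) :> series p R.
Proof.
apply/seriesP => n /=; case: eqP => [->|ne].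
  by rewrite mnm1E eqxx mulm1n eqxx.
by case: eqP => // E; case: eqP => // E1; case: ne; rewrite E E1 mulm1n.
Qed.

(** * Multiplication by powers of one variable *)

Section Powers.
Variables (p : nat) (R : comPzRingType) (M : lmodType R).
Implicit Types (i : 'I_p) (v : series p M).

Lemma coefs_XZ i v n :
  coefs ((seriesX i : series p R) *: v) n =
  if (0 < n i)%N then coefs v (n - U_(i))%MM else 0.
Proof.
rewrite seriesX_univ coefs_univZ big_ord_recl scale0r add0r.
case: (n i) => [|m]; first by rewrite big_ord0.
rewrite big_ord_recl scale1r mulm1n big1 ?addr0 // => k _.
by rewrite scale0r.
Qed.

Lemma coefs_XnZ i k v n :
  coefs ((seriesX i : series p R) ^+ k *: v) n =
  if (k <= n i)%N then coefs v (n - U_(i) *+ k)%MM else 0.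
Proof.
elim: k n => [|k IH] n; first by rewrite expr0 scale1r mulm0n subm0.
rewrite exprS -scalerA coefs_XZ IH mnmBE mnm1E eqxx.
have -> : (k < n i)%N = (0 < n i)%N && (k <= n i - 1)%N.
  by case: (n i) => //= m; rewrite subn1.
case: ifP => // _; case: ifP => //= _.
by congr coefs; apply/mnmP => l; rewrite !mnmBE !mulmnE -subnDA mulnS.
Qed.

Lemma coefs_CXnZ i (a : R) k v n :
  coefs ((seriesC a * seriesX i ^+ k) *: v) n =
  a *: (if (k <= n i)%N then coefs v (n - U_(i) *+ k)%MM else 0).
Proof. by rewrite -scalerA coefs_scaleC coefs_XnZ. Qed.

End Powers.

Lemma coefs_XnM p (R : comPzRingType) (i : 'I_p) k (g : series p R) n :
  coefs (seriesX i ^+ k * g) n =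
  if (k <= n i)%N then coefs g (n - U_(i) *+ k)%MM else 0.
Proof. exact: (coefs_XnZ i k (g : series p R^o)). Qed.

Lemma coefs_CXn p (R : comPzRingType) (i : 'I_p) (a : R) k n :
  coefs (seriesC a * seriesX i ^+ k) n =
  if n == (U_(i) *+ k)%MM then a else 0.
Proof.
rewrite [LHS](coefs_scaleC (M := R^o)) -[_ ^+ k]mulr1 coefs_XnM coefs1.
have -> : (n == (U_(i) *+ k)%MM)
    = (k <= n i)%N && ((n - U_(i) *+ k)%MM == 0%MM).
  rewrite -mnmU_muln_le; apply/eqP/andP => [->|[le_kn /eqP E]].
    by split; [exact/mnm_lepP|rewrite -[X in (X - _)%MM]add0m addmK].
  by rewrite -(submK le_kn) E add0m.
case: ifP => /= [_|_]; last exact: mulr0.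
by case: eqP => _; [exact: mulr1|exact: mulr0].
Qed.

(** The factors involve distinct variables, so [n] splits among them in only one way that can
    contribute. *)
Lemma coefs_prod_univ p (R : comPzRingType) (f : 'I_p -> nat -> R)
    (n : 'X_{1..p}) :
  coefs (\prod_(i < p) series_univ i (f i)) n = \prod_(i < p) f i (n i).
Proof.
(* Induction needs partial products: a product over a duplicate-free list [r] is constant in the
   variables outside [r], so every exponent outside [r] must vanish. *)
suff gen r : uniq r -> forall n, coefs (\prod_(i <- r) series_univ i (f i)) n =
    if [forall i, (i \notin r) ==> (n i == 0%N)]
    then \prod_(i <- r) f i (n i) else 0.
  rewrite gen ?index_enum_uniq //; case: ifPn => // /forallPn[i].
  by rewrite mem_index_enum.
elim: r => [_ {}n|i r IH /= /andP[ir ur] {}n].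
  rewrite !big_nil coefs1; case: eqP => [->|ne].
    by rewrite ifT //; apply/forallP => i; rewrite mnm0E.
  case: forallP => // H; case: ne; apply/mnmP => i; rewrite mnm0E.
  exact/eqP/H.
(* Only k = n_i survives: a smaller k leaves a positive power of t_i to the product over [r], which
   does not contain [i]. *)
rewrite !big_cons coefs_univM big_ord_recr big1 /= ?add0r; last first.
  move=> k _; rewrite IH //; case: forallP => [/(_ i)|_]; last exact: mulr0.
  by rewrite ir mnmBE mnmU_muln eqxx subn_eq0 leqNgt ltn_ord.
rewrite IH //.
have -> : [forall l, (l \notin r) ==> ((n - U_(i) *+ n i)%MM l == 0%N)]
    = [forall l, (l \notin i :: r) ==> (n l == 0%N)].
  apply: eq_forallb => l; rewrite mnmBE mnmU_muln inE negb_or.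
  by case: (eqVneq i l) => [->|_] /=; rewrite ?subnn ?eqxx ?implybT ?subn0.
case: ifP => _; last exact: mulr0.
congr (_ * _); apply: eq_big_seq => l lr; rewrite mnmBE mnmU_muln.
by case: eqP => [E|_]; [rewrite E lr in ir|rewrite subn0].
Qed.

(** * Coefficients of the denominators and of the numerator factors *)

Section Denominator.
Variables (p : nat) (R : comPzRingType) (d : nat) (a : 'I_d -> R).

(** The sum has at most one term: it reads off a_m when 1 <= m <= d and is 0 otherwise, so that the
    coefficients of q are defined at every natural number. *)
Definition fib_q_coef (m : nat) : R :=
  (m == 0%N)%:R - \sum_(k < d | m == k.+1) a k.

Lemma fib_q_coef_gt m : (d < m)%N -> fib_q_coef m = 0.
Proof.
move=> dm; rewrite /fib_q_coef gtn_eqF ?(leq_ltn_trans _ dm) //.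
rewrite big_pred0 ?subr0 //.
by move=> k; rewrite gtn_eqF // (leq_ltn_trans _ dm).
Qed.

Lemma fib_q_univ (i : 'I_p) : fib_q a (seriesX i) = series_univ i fib_q_coef.
Proof.
apply/seriesP => n; rewrite /fib_q coefsB coefs1 coefs_sum.
under eq_bigr do rewrite coefs_CXn.
rewrite -big_mkcond /=; case: (n =P (U_(i) *+ n i)%MM) => [E|ne].
  rewrite /fib_q_coef {1}E; congr (_%:R - _).
    by rewrite -!mdeg_eq0 mdegMn mdeg1 mul1n.
  apply: eq_bigl => k; rewrite {1}E; apply/eqP/eqP => [|->//].
  by move=> /(congr1 (fun m : 'X_{1..p} => m i)); rewrite !mnmU_muln eqxx.
have -> : (n == 0%MM) = false.
  by apply/eqP => E; case: ne; rewrite E mnm0E mulm0n.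
rewrite big_pred0 ?subr0 // => k; apply/eqP => E; case: ne.
by rewrite E mnmU_muln eqxx.
Qed.

Lemma fib_Q_univ (i : 'I_p) (j : 'I_d) : fib_Q a j (seriesX i) =
  series_univ i (fun m => if (j <= m < d)%N then fib_q_coef (m - j) else 0).
Proof.
apply/seriesP => n; rewrite /fib_Q coefs_XnM coefsB coefs1 coefs_sum.
under eq_bigr do rewrite coefs_CXn.
rewrite -big_mkcondr /=.
case: (leqP j (n i)) => jn /=; last by rewrite if_same.
have shift k : ((n - U_(i) *+ j)%MM == (U_(i) *+ k)%MM)
    = (n == (U_(i) *+ n i)%MM) && (n i - j == k)%N.
  have le_jn : (U_(i) *+ j <= n)%MM by rewrite mnmU_muln_le.
  apply/eqP/andP => [E|[/eqP E /eqP <-]].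
    have En : n = (U_(i) *+ (k + j))%MM.
      rewrite -(submK le_jn) E.
      by apply/mnmP => l; rewrite mnmDE !mulmnE mulnDr.
    by rewrite En mnmU_muln eqxx addnK !eqxx.
  apply/mnmP => l; rewrite mnmBE [in LHS]E !mnmU_muln.
  by case: eqP.
have -> : ((n - U_(i) *+ j)%MM == 0%MM)
    = (n == (U_(i) *+ n i)%MM) && (n i - j == 0)%N.
  by rewrite -shift mulm0n.
under eq_bigl do rewrite shift.
case: eqP => _ /=; last by rewrite big_pred0 ?subr0 // => k; rewrite andbF.
(* For n_i < d, the equation n_i - j = k + 1 already forces the cutoff k + 1 <= d - j - 1. For n_i
   >= d it contradicts the cutoff, and the constant term is absent too because j < d <= n_i. *)
case: ltnP => nd.
  congr (_ - _); apply: eq_bigl => k; lia.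
rewrite big_pred0 => [|k]; last by have := ltn_ord j; lia.
by rewrite subr0 gtn_eqF // subn_gt0 (leq_trans _ nd).
Qed.

End Denominator.

Lemma coefs_scale_seriesC p (R : comPzRingType) (M : lmodType R)
    (f : series p R) (v : M) n :
  coefs (f *: (seriesC v : series p M)) n = coefs f n *: v.
Proof.
rewrite (coefsZ_le _ _ (ltnSn _)).
rewrite (bigD1 (BMultinom (ltnSn (mdeg n)))) /=; last exact/mnm_lepP.
rewrite ifT; last by apply/eqP/mnmP => i; rewrite mnmBE subnn mnm0E.
rewrite big1 ?addr0 // => m /andP[le_mn ne].
rewrite ifF ?scaler0 //; apply: contraNF ne => /eqP E; apply/eqP/val_inj => /=.
by have := submK le_mn; rewrite E add0m.
Qed.

(* Multiplying by series in the other variables leaves n_i unchanged. *)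
Lemma coefs_prod_univZ_eq0 p (R : comPzRingType) (M : lmodType R) (i : 'I_p) b
    (P : pred 'I_p) (f : 'I_p -> nat -> R) (v : series p M) :
    ~~ P i -> (forall n : 'X_{1..p}, (b <= n i)%N -> coefs v n = 0) ->
  forall n : 'X_{1..p}, (b <= n i)%N ->
    coefs ((\prod_(k < p | P k) series_univ k (f k)) *: v) n = 0.
Proof.
move=> nPi; move: v.
(* [K g] says that multiplication by [g] preserves vanishing for n_i >= b; it holds for 1 and is
   stable under products, so single factors suffice. *)
pose K g := forall v : series p M,
  (forall n : 'X_{1..p}, (b <= n i)%N -> coefs v n = 0) ->
  forall n : 'X_{1..p}, (b <= n i)%N -> coefs (g *: v) n = 0.
apply: (big_ind K) => [v v0 n nb|g h Kg Kh v v0 n nb|k Pk v v0 n nb].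
- by rewrite scale1r v0.
- by rewrite -scalerA (Kg (h *: v)) // => m mb; apply: Kh.
- rewrite coefs_univZ big1 // => m _; rewrite v0 ?scaler0 //.
  rewrite mnmBE mnmU_muln ifF ?subn0 //.
  by apply: contraNF nPi => /eqP <-.
Qed.

(** * The product of denominator and generating function, and rationality *)

Section Fibonacci.
Variables (R : comPzRingType) (M : lmodType R) (p : nat) (d : 'I_p -> nat).
Variables (a : forall i : 'I_p, 'I_(d i) -> R) (x : 'X_{1..p} -> M).
Arguments a : clear implicits.
Hypothesis hx : multiple_fibonacci a x.

Let q : series p R := \prod_(i < p) fib_q (a i) (seriesX i).

Let num : series p M :=
  \sum_(j : {dffun forall i : 'I_p, 'I_(d i)})
    (\prod_(i < p) fib_Q (a i) (j i) (seriesX i)) *: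
      seriesC (x [multinom nat_of_ord (j i) | i < p]).

Lemma fib_denE : q = \prod_(i < p) series_univ i (fib_q_coef (a i)).
Proof. by apply: eq_bigr => i _; rewrite fib_q_univ. Qed.

Lemma coefs_fib_qZ_eq0 (i : 'I_p) (n : 'X_{1..p}) : (d i <= n i)%N ->
  coefs (fib_q (a i) (seriesX i) *: generating_function x) n = 0.
Proof.
move=> dn; have le_dn : (U_(i) *+ d i <= n)%MM by rewrite mnmU_muln_le.
rewrite /fib_q scalerBl scale1r scaler_suml coefsB coefs_sum.
under eq_bigr => k _.
  rewrite coefs_CXnZ (leq_trans _ dn) //.
  over.
(* Writing [n] as (n - d_i e_i) + d_i e_i, with e_i the i-th unit exponent, exposes the recurrence,
   whose terms cancel one by one against those of q_i. *)
rewrite /= -[X in x X - _](submK le_dn) hx -sumrB big1 // => k _.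
suff -> : (n - U_(i) *+ d i + U_(i) *+ (d i - k.+1))%MM
    = (n - U_(i) *+ k.+1)%MM by rewrite subrr.
apply/mnmP => l; rewrite mnmDE !mnmBE !mnmU_muln.
by have := ltn_ord k; case: eqP => [<-|_]; lia.
Qed.

Lemma coefs_fib_denZ_eq0 (i : 'I_p) (n : 'X_{1..p}) : (d i <= n i)%N ->
  coefs (q *: generating_function x) n = 0.
Proof.
have -> : q = (\prod_(k < p | k != i) series_univ k (fib_q_coef (a k))) *
    fib_q (a i) (seriesX i).
  rewrite /q (bigD1 i) //= mulrC; congr (_ * _).
  by apply: eq_bigr => k _; rewrite fib_q_univ.
rewrite -scalerA.
move=> dn; apply: (coefs_prod_univZ_eq0 (i := i) (b := d i)) => //.
  by rewrite eqxx.
exact: coefs_fib_qZ_eq0.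
Qed.

Lemma coefs_fib_num n : coefs num n =
  \sum_(j : {dffun forall i : 'I_p, 'I_(d i)})
    (\prod_(i < p) if (j i <= n i < d i)%N
                   then fib_q_coef (a i) (n i - j i) else 0) *:
      x [multinom nat_of_ord (j i) | i < p].
Proof.
rewrite /num coefs_sum; apply: eq_bigr => j _; rewrite coefs_scale_seriesC.
by under eq_bigr do rewrite fib_Q_univ; rewrite coefs_prod_univ.
Qed.

Lemma fib_den_gf : q *: generating_function x = num.
Proof.
apply/seriesP => n; rewrite coefs_fib_num.
(* Outside the box both sides vanish: the left by the recurrence, the right because each product
   contains a truncated factor. *)
have [/forallP nd|/forallPn[i]] := boolP [forall i, n i < d i]%N; last first.
  rewrite -leqNgt => dn; rewrite (coefs_fib_denZ_eq0 dn) big1 // => j _.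
  by rewrite (bigD1 i) //= [(n i < d i)%N]ltnNge dn andbF mul0r scale0r.
have subn_lt (m : 'X_{1..p}) i : ((n - m)%MM i < d i)%N.
  by rewrite mnmBE (leq_ltn_trans (leq_subr _ _)).
pose mnm (j : {dffun forall i : 'I_p, 'I_(d i)}) : 'X_{1..p} :=
  [multinom nat_of_ord (j i) | i < p].
have mnmjE j i : mnm j i = j i by rewrite mnmE.
(* The Cauchy sum runs over the exponent [m] taken from q, the numerator over the index [j] of x.
   They are exchanged by j = n - m, which stays in the box since [n] does. *)
pose box (m : 'X_{1..p}) : {dffun forall i : 'I_p, 'I_(d i)} :=
  [ffun i => Ordinal (subn_lt m i)].
have boxE m i : box m i = (n i - m i)%N :> nat by rewrite ffunE /= mnmBE.
have sub_deg (m : 'X_{1..p}) : (mdeg (n - m)%MM < (mdeg n).+1)%N.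
  by rewrite ltnS mdegB.
rewrite (coefsZ_le _ _ (ltnSn _)).
rewrite (reindex_onto (fun j => BMultinom (sub_deg (mnm j)))
  (fun m => box (bmnm m))) /=; last first.
  move=> m /mnm_lepP le_mn; apply/val_inj/mnmP => i /=.
  by rewrite mnmBE mnmjE boxE subKn.
rewrite big_mkcond; apply: eq_bigr => j _.
(* Subtraction is truncated, so j is recovered from n - j exactly when j <= n componentwise; every
   other j has a zero factor in the numerator. *)
have -> : ((n - mnm j <= n)%MM
    && (box (n - mnm j)%MM == j))
    = [forall i, j i <= n i]%N.
  apply/andP/forallP => [[_ /eqP <-] i|le_jn].
    by rewrite boxE leq_subr.
  split; first by apply/mnm_lepP => i; rewrite mnmBE leq_subr.
  apply/eqP/ffunP => i; apply/val_inj.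
  by rewrite /= boxE mnmBE mnmjE subKn.
case: forallP => [le_jn|/forallP/forallPn[i nle]]; last first.
  by rewrite (bigD1 i) //= (negPf nle) mul0r scale0r.
congr (_ *: x _).
  rewrite fib_denE coefs_prod_univ; apply: eq_bigr => i _.
  by rewrite le_jn nd mnmBE mnmjE.
by apply/mnmP => i; rewrite !mnmBE mnmjE subKn.
Qed.

Lemma fib_den_mulV :
  (\prod_(i < p) series_inv (fib_q (a i) (seriesX i))) * q = 1.
Proof.
rewrite /q -big_split big1 //= => i _.
exact/series_mulVf/fib_q_unit.
Qed.

Lemma fib_den_unit : series_unit q.
Proof. by eexists; exact: fib_den_mulV. Qed.

(** If every n_i were at most d_i, the total degree could not exceed the sum of the d_i. The strict
    inequality is what q requires, since q_i may have a term of degree d_i. *)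
Lemma mdeg_ge_box (n : 'X_{1..p}) :
  ((\sum_(i < p) d i).+1 <= mdeg n)%N -> exists i, (d i < n i)%N.
Proof.
move=> dn; apply/existsP; apply: contraLR dn => /existsPn le_nd.
by rewrite -ltnNge ltnS mdegE leq_sum // => i _; rewrite leqNgt.
Qed.

Lemma fib_den_polynomial : series_polynomial q.
Proof.
exists (\sum_(i < p) d i).+1 => n /mdeg_ge_box[i dn].
by rewrite fib_denE coefs_prod_univ (bigD1 i) //= fib_q_coef_gt ?mul0r.
Qed.

Lemma fib_num_polynomial : series_polynomial num.
Proof.
exists (\sum_(i < p) d i).+1 => n /mdeg_ge_box[i dn].
(* The numerator inherits its bounded support from q G. *)
by rewrite -fib_den_gf (coefs_fib_denZ_eq0 (ltnW dn)).
Qed.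

Lemma fib_gf : generating_function x = series_inv q *: num.
Proof.
by rewrite -fib_den_gf scalerA series_mulVf ?scale1r //; exact: fib_den_unit.
Qed.

Lemma fib_gf_rational : series_rational (generating_function x).
Proof.
exists q, num; split; [exact: fib_den_polynomial|exact: fib_den_unit|
  exact: fib_num_polynomial|exact: fib_gf].
Qed.

End Fibonacci.

Theorem proposition3p7 (R : comPzRingType) (M : lmodType R) (p : nat)
    (hp : (1 <= p)%N) (d : 'I_p -> nat) (hd : forall i : 'I_p, (1 <= d i)%N)
    (a : forall i : 'I_p, 'I_(d i) -> R) (x : 'X_{1..p} -> M)
    (hx : multiple_fibonacci a x) :
  series_rational (generating_function x) /\
  generating_function x =
    (\prod_(i < p) series_inv (fib_q (a i) (seriesX i))) *:
    (\sum_(j : {dffun forall i : 'I_p, 'I_(d i)})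
       (\prod_(i < p) fib_Q (a i) (j i) (seriesX i)) *:
         seriesC (x [multinom nat_of_ord (j i) | i < p])).
Proof.
split; first exact: fib_gf_rational hx.
(* By uniqueness of inverses, the product of the inverses of the q_i is the inverse of their
   product. *)
by rewrite -(series_invE (fib_den_mulV a)); exact: fib_gf.
Qed.
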